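(* Let $p>5$ be a Mersenne prime (i.e. $p=2^n-1$ for some integer $n$) with $p\equiv \pm 2 \pmod 5$. Let $\mathbf{x}=(x_1,x_2,x_3)\in\mathbb{F}_p^3$ satisfy $x_1^2+x_2^2+x_3^2=3x_1x_2x_3$ in $\mathbb{F}_p$. Suppose that for some $i\in\{1,2,3\}$ the order of the matrix \[\begin{pmatrix} 0 & 1 \\ -1 & 3x_i \end{pmatrix}\] in $\mathrm{GL}_2(\mathbb{F}_p)$ is at least $p+1$. Then $\mathbf{x}$ has an integer lift, i.e. there exists $(a,b,c)\in\mathbb{Z}^3$ with $a^2+b^2+c^2=3abc$ and $(a,b,c)\equiv (x_1,x_2,x_3)\pmod p$. *)

(* Defs.v *)
From HB Require Import structures.
From mathcomp Require Import all_boot all_order all_algebra all_fingroup.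

Set Implicit Arguments.
Unset Strict Implicit.
Unset Printing Implicit Defensive.

Import GRing.Theory.
Local Open Scope ring_scope.

Definition mersenne_prime (p : nat) : Prop :=
  prime p /\ exists n : nat, p = (2 ^ n - 1)%N.

Definition markoff (R : comNzRingType) (x1 x2 x3 : R) : Prop :=
  x1 ^+ 2 + x2 ^+ 2 + x3 ^+ 2 = 3 * x1 * x2 * x3.

Definition markoff_mx (R : nzRingType) (x : R) : 'M[R]_2 :=
  \matrix_(i, j) nth 0 (nth [::] [:: [:: 0; 1]; [:: -1; 3 * x]] i) j.

Lemma markoff_mx_unit (R : comUnitRingType) (x : R) : markoff_mx x \is a GRing.unit.
Proof.
rewrite -[_ \is a _]/(markoff_mx x \in unitmx) unitmxE.
rewrite (expand_det_row _ ord0) !big_ord_recl big_ord0 /cofactor !det_mx11.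
by rewrite !mxE /= mul0r mul1r expr1 mulrN1 opprK add0r addr0 unitr1.
Qed.

Definition markoff_rot (F : finFieldType) (x : F) : {'GL_2[F]} :=
  FinRing.Unit (markoff_mx_unit x).

(* Main.v *)
Require Import Defs.
From HB Require Import structures.
From mathcomp Require Import all_boot all_order all_algebra all_fingroup.
From mathcomp Require Import cyclic finfield ring lra zify.

Set Implicit Arguments.
Unset Strict Implicit.
Unset Printing Implicit Defensive.

Import Order.TTheory GRing.Theory Num.Theory.
Local Open Scope ring_scope.

(** In the coordinates t_i = 3 x_i the surface is t1^2 + t2^2 + t3^2 = t1 t2 t3.
    Since p + 1 = 2^n, the rotation of trace t has order p + 1 exactly when t is
    maximal: t - 2 is a nonzero square and t + 2 is not a square.  Then the
    rotation acts transitively on the conic of points with first coordinate t,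
    which has p + 1 points.  As 5 is not a square, 3 is maximal, and the conic
    above 3 is the orbit of the point (3, 3, 3), which lifts to (1, 1, 1).
    It remains to connect every maximal t to 3 through points (t, u, _) with u
    maximal; such a point exists iff (t^2 - 4)(u^2 - 4) - 16 is a square.
    Let A and B be the sets of values t^2 - 4 for the maximal t that are
    connected to 3 and for those that are not.  Then a b - 16 is a nonsquare for
    all a in A and b in B, and orthogonality of the rows of the quadratic
    character matrix (chi (a y - 16)) forces |A| |B| <= p.  On the other hand
    every maximal trace has at least p / 32 - O(1) neighbours: the count reduces
    to three sums of chi over cubics, each at most p / 4 + O(1) in absolute
    value by an explicit Stepanov polynomial vanishing to order 4.  So B is empty
    when p > 4800, which leaves p = 7 and p = 127. *)

(** * The quadratic character *)

Lemma sum_natr_card (T : finType) (P : pred T) :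
  \sum_x ((P x)%:R : int) = #|[set x | P x]|%:Z.
Proof.
rewrite -natz -sum1_card natr_sum [RHS]big_mkcond; apply: eq_bigr => x _.
by rewrite inE; case: (P x).
Qed.

Section QuadraticCharacter.

Variables (p : nat) (F : finFieldType).
Hypothesis charF : p \in [pchar F].
Hypothesis cardF : #|F| = p.
Hypothesis p3mod4 : (p %% 4 = 3)%N.

(** Euler's criterion is taken as the definition; values in [int] let character sums be estimated as
    integers. *)
Definition chi (x : F) : int :=
  if x == 0 then 0 else if x ^+ (#|F|.-1)./2 == 1 then 1 else -1.

Lemma natr_neq0 (m : nat) : (0 < m < p)%N -> m%:R != 0 :> F.
Proof.
by case/andP=> m0 mp; rewrite -(dvdn_pcharf charF); apply/negP => /(dvdn_leq m0); lia.
Qed.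

Lemma two_neq0 : 2 != 0 :> F.
Proof. apply: natr_neq0; lia. Qed.

Lemma expr_half (x : F) : x != 0 ->
  (x ^+ (#|F|.-1)./2 == 1) || (x ^+ (#|F|.-1)./2 == -1).
Proof.
move=> x0; rewrite -eqf_sqr expr1n -exprM; apply/eqP/(mulfI x0).
rewrite -exprS mulr1 -[RHS]expf_card; congr (_ ^+ _); rewrite cardF; lia.
Qed.

Lemma chi_expr (x : F) : (chi x)%:~R = x ^+ (#|F|.-1)./2.
Proof.
rewrite /chi; case: eqVneq => [->|x0].
  by rewrite expr0n; case: eqP => //; rewrite cardF; lia.
by case: eqP => [->//|/eqP/negPf h]; have := expr_half x0; rewrite h => /eqP ->.
Qed.

(** The difference is at most 2 in absolute value, hence below [p], so it vanishes in [F] only if it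
    is 0. Identities for [chi] thus reduce to identities between powers in [F]. *)
Lemma intr_sign_inj (a b : int) :
  `|a| <= 1 -> `|b| <= 1 -> a%:~R = b%:~R :> F -> a = b.
Proof.
move=> ha hb; have [|] : (a = b \/ (a - b) != 0) by case: (eqVneq a b); lia.
  by [].
move=> d /eqP; rewrite -subr_eq0 -rmorphB /= => h.
have /natr_neq0 : (0 < `|a - b|%N < p)%N by lia.
move=> nz; case/negP: nz.
have [e|e] : a - b = `|a - b|%N \/ a - b = - (`|a - b|%N)%:Z by lia.
  by rewrite e in h.
by rewrite e rmorphN oppr_eq0 in h.
Qed.

Lemma chi_bound x : `|chi x| <= 1.
Proof. by rewrite /chi; case: eqP => //; case: eqP. Qed.

Lemma chi0 : chi 0 = 0.
Proof. by rewrite /chi eqxx. Qed.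

Lemma chi_eq0 x : (chi x == 0) = (x == 0).
Proof. by rewrite /chi; case: (x == 0) => //; case: (_ == 1). Qed.

Lemma chi_cases x : x != 0 -> chi x = 1 \/ chi x = -1.
Proof. by rewrite /chi => /negPf ->; case: eqP; [left|right]. Qed.

Lemma chiM x y : chi (x * y) = chi x * chi y.
Proof.
apply: intr_sign_inj; last by rewrite rmorphM /= !chi_expr exprMn.
  exact: chi_bound.
by have := chi_bound x; have := chi_bound y; nia.
Qed.

Lemma chi_sqr x : x != 0 -> chi (x ^+ 2) = 1.
Proof. by rewrite expr2 chiM => /chi_cases[] ->. Qed.

Lemma chi1 : chi 1 = 1.
Proof. by rewrite /chi oner_eq0 expr1n eqxx. Qed.

Lemma chiN x : chi (- x) = - chi x.
Proof.
have -> : - x = -1 * x by rewrite mulN1r.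
rewrite chiM; suff -> : chi (-1) = -1 by rewrite mulN1r.
apply: intr_sign_inj; rewrite ?chi_bound ?normrN1 // chi_expr -signr_odd.
by have -> : odd (#|F|.-1)./2 by rewrite cardF; lia.
Qed.

(* As [#|F| = 3 mod 4], raising a square to the power [(#|F| + 1) / 4]
   extracts a square root. *)
Lemma chi_ge0_sqrt x : 0 <= chi x -> exists y, y ^+ 2 = x.
Proof.
rewrite /chi; case: eqVneq => [->|x0]; first by exists 0; rewrite expr0n.
case: eqP => // x1 _; exists (x ^+ (p.+1 %/ 4)).
rewrite -exprM -[RHS]mulr1 -x1 -exprS; congr (_ ^+ _); rewrite cardF; lia.
Qed.

Lemma chi_lt0 x : (forall y, y ^+ 2 != x) -> chi x = -1.
Proof.
move=> h; have [x0|/chi_cases[c|//]] := eqVneq x 0.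
  by have := h 0; rewrite x0 expr0n eqxx.
have [|y yx] := @chi_ge0_sqrt x; first by rewrite c.
by have := h y; rewrite yx eqxx.
Qed.

Lemma card_sqrt (v : F) : #|[set y | y ^+ 2 == v]|%:Z = 1 + chi v.
Proof.
have [->|v0] := eqVneq v 0.
  have -> : [set y : F | y ^+ 2 == 0] = [set 0].
    by apply/setP => y; rewrite !inE sqrf_eq0.
  by rewrite cards1 chi0.
case: (chi_cases v0) => c; rewrite c.
  have [|y yx] := @chi_ge0_sqrt v; first by rewrite c.
  have y0 : y != 0 by apply: contra_neq v0 => y0; rewrite -yx y0 expr0n.
  have -> : [set z | z ^+ 2 == v] = [set y; - y].
    by apply/setP => z; rewrite !inE -yx eqf_sqr.
  rewrite cards2 -subr_eq0 opprK.
  by rewrite -mulr2n -mulr_natl mulf_neq0 // two_neq0.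
rewrite (_ : [set y | _] = set0) ?cards0 //; apply/setP => y; rewrite !inE.
apply/negP => /eqP yx; move: c; rewrite -yx chi_sqr //.
by apply: contra_neq v0 => y0; rewrite -yx y0 expr0n.
Qed.

(** Each [v] has [1 + chi v] square roots. Sums of even functions thereby drop in degree. *)
Lemma sum_sqr (G : F -> int) :
  \sum_y G (y ^+ 2) = \sum_v (1 + chi v) * G v.
Proof.
rewrite (partition_big (fun y => y ^+ 2) predT) //=; apply: eq_bigr => v _.
rewrite -card_sqrt (eq_bigl (mem [set y | y ^+ 2 == v])); last first.
  by move=> y; rewrite /= inE.
rewrite (eq_bigr (fun=> G v)) => [|y]; last by rewrite /= inE => /eqP ->.
by rewrite sumr_const -mulr_natl natz.
Qed.

Lemma sum_chi : \sum_x chi x = 0.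
Proof.
have h : \sum_x chi x = - \sum_x chi x.
  rewrite [LHS](reindex_inj oppr_inj) -sumrN; apply: eq_bigr => x _.
  exact: chiN.
lia.
Qed.

Lemma sum_chi_affine a b : a != 0 -> \sum_x chi (a * x + b) = 0.
Proof.
move=> a0; rewrite -[RHS]sum_chi [RHS](reindex (fun x => a * x + b)) //.
exists (fun y => (y - b) / a) => x _; field; exact: a0.
Qed.

(* For [x != 0] the summand is [chi (1 + (b - a) / (x - a))]. *)
Lemma sum_chi_quadratic a b : a != b -> \sum_x chi ((x - a) * (x - b)) = -1.
Proof.
move=> ab; have c0 : a - b != 0 by rewrite subr_eq0.
rewrite (reindex_inj (addIr a)) /=.
transitivity (\sum_(x | x != 0) chi (1 + (a - b) * x^-1)).
  rewrite (bigD1 0) //= add0r subrr mul0r chi0 add0r; apply: eq_bigr => x x0.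
  have -> : (x + a - a) * (x + a - b) = x ^+ 2 * (1 + (a - b) * x^-1).
    by field.
  by rewrite chiM chi_sqr // mul1r.
transitivity (\sum_(x | x != 0) chi ((a - b) * x + 1)).
  rewrite [RHS](reindex_inj invr_inj) /=; apply: eq_big => x.
    by rewrite invr_eq0.
  by rewrite addrC.
have := sum_chi_affine 1 c0; rewrite (bigD1 0) //= mulr0 add0r chi1 => /eqP.
by rewrite addrC addr_eq0 => /eqP.
Qed.

(** Putting [v = y ^+ 2] leaves the sum of [chi (v - e)], which is 0, and that of
    [chi (v * (v - e))], which is -1. *)
Lemma sum_chi_sqrB e : e != 0 -> \sum_y chi (y ^+ 2 - e) = -1.
Proof.
move=> e0; rewrite (sum_sqr (fun v => chi (v - e))).
under eq_bigr => v _ do rewrite mulrDl mul1r -chiM -[v in chi (v * _)]subr0.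
rewrite big_split /= sum_chi_quadratic 1?eq_sym // -[RHS]add0r; congr (_ + _).
rewrite -[RHS](@sum_chi_affine 1 (- e)) ?oner_eq0 //.
by apply: eq_bigr => v _; rewrite mul1r.
Qed.

End QuadraticCharacter.

(** * Stepanov's bound for cubics *)

Section Multiplicity.
Variable F : fieldType.

Lemma prod_XsubC_exp_dvdp (m : nat) (rs : seq F) (R : {poly F}) :
  uniq rs -> (forall a, a \in rs -> ('X - a%:P) ^+ m %| R) ->
  \prod_(a <- rs) ('X - a%:P) ^+ m %| R.
Proof.
elim: rs => [|a rs IH] /=; first by rewrite big_nil dvd1p.
case/andP=> ars urs dv; rewrite big_cons Gauss_dvdp.
  rewrite dv ?mem_head // IH // => b brs; apply: dv.
  by rewrite inE brs orbT.
rewrite big_seq; elim/big_ind: _ => [|f g cf cg|b brs].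
- exact: coprimep1.
- by rewrite coprimepMr cf cg.
apply/coprimep_expl/coprimep_expr/coprimep_XsubC2.
by rewrite subr_eq0; apply: contraNneq ars => <-.
Qed.

(** [P] is prime to ['X - a%:P], so all [m] factors supplied by [h] go into [R]. *)
Lemma XsubC_exp_dvdp_mulr (m : nat) (a : F) (P R h k : {poly F}) :
  P * R = h ^+ m * k -> root h a -> ~~ root P a -> ('X - a%:P) ^+ m %| R.
Proof.
move=> e ha Pa; rewrite -(@Gauss_dvdpr _ _ P).
  by rewrite e dvdp_mulr // dvdp_exp2r // dvdp_XsubCl.
by rewrite coprimep_expl // coprimep_sym coprimep_XsubC.
Qed.

Lemma leq_card_mul_roots (m : nat) (rs : seq F) (R : {poly F}) :
  R != 0 -> uniq rs -> (forall a, a \in rs -> ('X - a%:P) ^+ m %| R) ->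
  (m * size rs < size R)%N.
Proof.
move=> R0 urs dv.
have := dvdp_leq R0 (prod_XsubC_exp_dvdp urs dv); apply: leq_trans.
elim: rs {urs dv} => [|a rs IH]; first by rewrite big_nil size_poly1 muln0.
rewrite big_cons size_proper_mul ?size_exp_XsubC.
  by move: IH; set P := (\prod_(j <- _) _ : {poly F}); rewrite /=; lia.
rewrite mulf_neq0 // lead_coef_eq0 -size_poly_gt0; last exact: leq_trans IH.
by rewrite size_exp_XsubC.
Qed.

Lemma size_mul_leqS (f g : {poly F}) m n :
  (size f <= m.+1)%N -> (size g <= n.+1)%N -> (size (f * g)%R <= (m + n).+1)%N.
Proof.
move=> hf hg; apply: leq_trans (size_polyMleq _ _) _.
by lia.
Qed.

Lemma size_add_leq (f g : {poly F}) m :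
  (size f <= m)%N -> (size g <= m)%N -> (size (f + g)%R <= m)%N.
Proof. by move=> hf hg; rewrite (leq_trans (size_polyD _ _)) // geq_max hf. Qed.

End Multiplicity.

(** * Approximating a square root to fourth order *)

Section Taylor.
Variable R : comPzRingType.

(* [sqrt_num / sqrt_den] is the [2/1] Pade approximant, in [h], of the square
   root of [f * (f + f1 h + f2 h^2 + f3 h^3)]. *)
Definition sqrt_disc (f f1 f2 : R) : R := 4 * f * f2 - f1 ^+ 2.
(** In that square root the coefficients of [h^2] and [h^3] are [sqrt_disc / (8 f)] and
    [sqrt_lead / (16 f^2)]; their ratio fixes the denominator. *)
Definition sqrt_lead (f f1 f2 f3 : R) : R :=
  8 * f ^+ 2 * f3 - f1 * sqrt_disc f f1 f2.
Definition sqrt_den (f f1 f2 f3 h : R) : R :=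
  8 * f * sqrt_disc f f1 f2 - 4 * sqrt_lead f f1 f2 f3 * h.
Definition sqrt_num (f f1 f2 f3 h : R) : R :=
  8 * f ^+ 2 * sqrt_disc f f1 f2
  + 4 * f * (sqrt_disc f f1 f2 * f1 - sqrt_lead f f1 f2 f3) * h
  + (sqrt_disc f f1 f2 ^+ 2 - 2 * sqrt_lead f f1 f2 f3 * f1) * h ^+ 2.

Lemma sqrt_pade (f f1 f2 f3 h : R) :
  exists k, sqrt_den f f1 f2 f3 h ^+ 2 * f
              * (f + f1 * h + f2 * h ^+ 2 + f3 * h ^+ 3)
            - sqrt_num f f1 f2 f3 h ^+ 2 = h ^+ 4 * k.
Proof.
pose D := sqrt_disc f f1 f2; pose L := sqrt_lead f f1 f2 f3.
(* Terms below degree 4 in [h] cancel; the witness collects the coefficients of [h^4] and [h^5]. *)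
exists (f * (16 * L ^+ 2 * f2 - 64 * f * D * L * f3)
        - (D ^+ 2 - 2 * L * f1) ^+ 2 + 16 * L ^+ 2 * f * f3 * h).
rewrite {}/D {}/L /sqrt_num /sqrt_den /sqrt_lead /sqrt_disc; ring.
Qed.

End Taylor.

Section HornerPade.
Variables (R : comNzRingType) (f f1 f2 f3 h : {poly R}) (x : R).

Lemma horner_sqrt_den0 : h.[x] = 0 ->
  (sqrt_den f f1 f2 f3 h).[x] = 8 * f.[x] * (sqrt_disc f f1 f2).[x].
Proof.
rewrite -!horner_evalE => hx.
by rewrite rmorphB !rmorphM /= hx !rmorph_nat mulr0 subr0.
Qed.

Lemma horner_sqrt_num0 : h.[x] = 0 ->
  (sqrt_num f f1 f2 f3 h).[x] = 8 * f.[x] ^+ 2 * (sqrt_disc f f1 f2).[x].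
Proof.
rewrite -!horner_evalE => hx.
rewrite /sqrt_num; move: (sqrt_disc _ _ _) (sqrt_lead _ _ _ _) => D L.
rewrite !rmorphD !rmorphM /= hx !rmorph_nat.
by rewrite !(mulr0, addr0) expr2.
Qed.

End HornerPade.

(** * The auxiliary polynomial of a cubic *)

Section CubicSum.

Variables (p : nat) (F : finFieldType).
Hypothesis charF : p \in [pchar F].
Hypothesis cardF : #|F| = p.
Hypothesis p3mod4 : (p %% 4 = 3)%N.
Hypothesis p_gt3 : (3 < p)%N.
Variables a b c d : F.
Hypothesis a_neq0 : a != 0.

Let f : {poly F} := Poly [:: d; c; b; a].
(** [f1], [f2], [f3] are the Taylor coefficients of [f]; the increment [h] below vanishes on all of
    [F]. *)
Let f1 : {poly F} := Poly [:: c; 2 * b; 3 * a].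
Let f2 : {poly F} := Poly [:: b; 3 * a].
Let f3 : {poly F} := Poly [:: a].
Let h : {poly F} := 'X ^+ p - 'X.
Let u : {poly F} := f ^+ (#|F|.-1)./2.
Let D := sqrt_disc f f1 f2.
Let L := sqrt_lead f f1 f2 f3.

Let PolyE := (cons_poly_def, mul0r, add0r).

(** Spelled out to read off the leading coefficient [3 a^2], nonzero since [p > 3]. *)
Lemma cubic_discE :
  D = Poly [:: 4 * b * d - c ^+ 2; 12 * a * d; 6 * a * c; 4 * a * b; 3 * a ^+ 2].
Proof. rewrite /D /sqrt_disc /f /f1 /f2 /= !PolyE; ring. Qed.

Lemma cubic_leadE :
  L = Poly [:: 8 * a * d ^+ 2 - 4 * b * c * d + c ^+ 3;
              4 * a * c * d - 8 * b ^+ 2 * d + 2 * b * c ^+ 2;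
              5 * a * c ^+ 2 - 20 * a * b * d; - (20 * a ^+ 2 * d);
              - (5 * a ^+ 2 * c); - (2 * a ^+ 2 * b); - a ^+ 3].
Proof.
rewrite /L /sqrt_lead -/D cubic_discE /f /f1 /f3 /= !PolyE; ring.
Qed.

(** Frobenius fixes the coefficients, so the left side is [f] evaluated at ['X ^+ p = 'X + h]. *)
Lemma cubic_frobenius :
  f ^+ p = f + f1 * h + f2 * h ^+ 2 + f3 * h ^+ 3.
Proof.
have pF : [pchar {poly F}].-nat p.
  by rewrite pnatE ?(pcharf_prime charF) // pchar_poly.
have pD (g k : {poly F}) : (g + k) ^+ p = g ^+ p + k ^+ p.
  exact: exprDn_pchar.
have cF x : (x%:P : {poly F}) ^+ p = x%:P by rewrite -rmorphXn -cardF /= expf_card.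
rewrite /f /f1 /f2 /f3 /h /= !PolyE !(pD, exprMn, cF); ring.
Qed.

Lemma size_cubic : size f = 4.
Proof. by rewrite (@PolyK _ 0). Qed.

Lemma size_cubic_lead : size L = 7.
Proof. by rewrite cubic_leadE (@PolyK _ 0) //= oppr_eq0 expf_neq0. Qed.

Lemma cubic_disc_neq0 : D != 0.
Proof.
rewrite -size_poly_gt0 cubic_discE (@PolyK _ 0) //=.
by rewrite mulf_neq0 ?expf_neq0 //; apply: (natr_neq0 charF).
Qed.

Lemma size_cubic_half : size u = (3 * (p.-1)./2).+1.
Proof.
have u0 : u != 0 by rewrite expf_neq0 // -size_poly_gt0 size_cubic.
by rewrite -[size u]prednK ?size_poly_gt0 // size_exp size_cubic cardF.
Qed.

Lemma size_frob : size h = p.+1.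
Proof. by rewrite size_polyDl size_polyXn // size_polyN size_polyX; lia. Qed.

Lemma cubic_halfE : f * u ^+ 2 = f ^+ p.
Proof. by rewrite -exprM -exprS cardF; congr (_ ^+ _); lia. Qed.

(** [f * u] is an exact square root of [f * f ^+ p], and the Pade quotient agrees with it up to sign
    to order [h^4]; [S e] compares the two for the sign [e]. *)
Let S (e : F) : {poly F} :=
  sqrt_den f f1 f2 f3 h * f * u - e%:P * sqrt_num f f1 f2 f3 h.

Lemma stepanovM e : e ^+ 2 = 1 -> exists k, S (- e) * S e = h ^+ 4 * k.
Proof.
move=> e2; have [k hk] := sqrt_pade f f1 f2 f3 h; exists k.
rewrite -hk -cubic_frobenius -cubic_halfE.
have {e2} e2 : e%:P ^+ 2 = 1 :> {poly F} by rewrite -rmorphXn e2.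
rewrite /S polyCN; move: (sqrt_den _ _ _ _ _) (sqrt_num _ _ _ _ _) => P Q.
rewrite -[Q ^+ 2]mul1r -e2; ring.
Qed.

(** The term [-4 L h f u] has degree [6 + p + 3 + 3 (p - 1) / 2], more than any other; the closest
    rival in [p] has degree [2 p + 8]. In particular [S e] is nonzero. *)
Lemma size_stepanov e : size (S e) = (p + 3 * (p.-1)./2 + 10)%N.
Proof.
have sf : (size f <= 4)%N by rewrite size_cubic.
have sf1 : (size f1 <= 3)%N by apply: size_Poly.
have sD : (size D <= 5)%N by rewrite cubic_discE; apply: size_Poly.
have sL : (size L <= 7)%N by rewrite size_cubic_lead.
have su : (size u <= (3 * (p.-1)./2).+1)%N by rewrite size_cubic_half.
have sh : (size h <= p.+1)%N by rewrite size_frob.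
have sc (x : F) : (size x%:P <= 1)%N by apply: size_polyC_leq1.
have four0 : 4 != 0 :> F.
  by rewrite (natrM _ 2 2) mulf_neq0 ?(two_neq0 charF cardF p3mod4).
pose q := (p.-1)./2.
have -> : S e = (- 4)%:P * (L * h * f * u) + ((8%:P * (f * D * f * u)
  - e%:P * (8%:P * (f ^+ 2 * D) + 4%:P * (f * (D * f1 - L) * h)
     + (D ^+ 2 - 2%:P * (L * f1)) * h ^+ 2))).
  rewrite /S /sqrt_den /sqrt_num -/D -/L; ring.
have s0 : size ((- 4)%:P * (L * h * f * u)) = (p + 3 * q + 10)%N.
  have u0 : u != 0 by rewrite -size_poly_gt0 size_cubic_half.
  have f0 : f != 0 by rewrite -size_poly_gt0 size_cubic.
  have h0 : h != 0 by rewrite -size_poly_gt0 size_frob.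
  have L0 : L != 0 by rewrite -size_poly_gt0 size_cubic_lead.
  rewrite mul_polyC size_scale ?oppr_eq0 // !size_mul ?mulf_neq0 //.
  by rewrite size_cubic_lead size_cubic size_cubic_half size_frob -/q; lia.
have s1 :=
  size_mul_leqS (sc 8) (size_mul_leqS (size_mul_leqS (size_mul_leqS sf sD) sf) su).
have sf2 : (size (f ^+ 2) <= 7)%N := size_mul_leqS sf sf.
have sD2 : (size (D ^+ 2) <= 9)%N := size_mul_leqS sD sD.
have sh2 : (size (h ^+ 2) <= (p + p).+1)%N := size_mul_leqS sh sh.
have sDL : (size (D * f1 - L)%R <= 7)%N.
  by apply: size_add_leq (size_mul_leqS sD sf1) _; rewrite size_polyN.
have sDL2 : (size (D ^+ 2 - 2%:P * (L * f1))%R <= 9)%N.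
  apply: size_add_leq sD2 _.
  by rewrite size_polyN; apply: size_mul_leqS (sc 2) (size_mul_leqS sL sf1).
have s2 := size_mul_leqS (sc 8) (size_mul_leqS sf2 sD).
have s3 := size_mul_leqS (sc 4) (size_mul_leqS (size_mul_leqS sf sDL) sh).
have s4 := size_mul_leqS sDL2 sh2.
rewrite size_polyDl // s0 addnS ltnS; apply: size_add_leq.
  by apply: leq_trans s1 _; rewrite /q; lia.
rewrite size_polyN -[X in (_ <= X)%N]add0n addnS; apply: size_mul_leqS (sc e) _.
apply: size_add_leq; first apply: size_add_leq.
- by apply: leq_trans s2 _; lia.
- by apply: leq_trans s3 _; rewrite /q; lia.
by apply: leq_trans s4 _; rewrite /q; lia.
Qed.


(* [S e] vanishes to order four at every [x] with [f.[x] ^+ q = e], except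
   possibly at the roots of [D], where [S (- e)] vanishes as well. *)
Lemma card_cubic_chi (e : int) : e ^+ 2 = 1 ->
  (8 * #|[set x | chi f.[x] == e]| <= 5 * p + 47)%N.
Proof.
move=> e2; pose A := [set x | (chi f.[x] == e) && ~~ root D x].
have [k SM] : exists k, S (- e%:~R) * S e%:~R = h ^+ 4 * k.
  by apply: stepanovM; rewrite -rmorphXn e2.
have Sne : S e%:~R != 0 by rewrite -size_poly_gt0 size_stepanov; lia.
have cA : (4 * #|A| < p + 3 * (p.-1)./2 + 10)%N.
  rewrite -(size_stepanov e%:~R) cardE.
  apply: leq_card_mul_roots => //; first exact: enum_uniq.
  move=> x; rewrite mem_enum inE => /andP[/eqP fx Dx].
  have hx : h.[x] = 0 by rewrite !hornerE -[in X in X - _]cardF expf_card subrr.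
  apply: (XsubC_exp_dvdp_mulr SM); rewrite /root ?hx //.
  have ux : u.[x] = e%:~R by rewrite horner_exp -fx (chi_expr charF cardF).
  have e2F : (e%:~R : F) ^+ 2 = 1 by rewrite -rmorphXn e2.
  have fx0 : f.[x] != 0.
    by rewrite -chi_eq0 fx; apply: contra_eq_neq e2 => ->; rewrite expr0n.
  (* As [h] vanishes at [x], the two halves of [S (- e)] are equal there and add up instead of
     cancelling. *)
  rewrite /S hornerD hornerN !hornerM horner_sqrt_den0 // horner_sqrt_num0 //.
  rewrite ux hornerC -/D (_ : _ - _ = 16 * f.[x] ^+ 2 * D.[x] * e%:~R); last by ring.
  have two0 := two_neq0 charF cardF p3mod4.
  rewrite !mulf_neq0 ?expf_neq0 //; first by rewrite (natrX _ 2 4) expf_neq0.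
  by apply: contra_eq_neq e2F => ->; rewrite expr0n eq_sym oner_neq0.
(* At most four points were left out, adding 32 to [8 |A| <= 5 p + 15]. *)
have cD : (#|[set x | root D x]| < 5)%N.
  have sD : (size D <= 5)%N by rewrite cubic_discE; apply: size_Poly.
  apply: leq_trans sD; rewrite cardE; apply: max_poly_roots.
  - exact: cubic_disc_neq0.
  - by apply/allP => x; rewrite mem_enum inE.
  exact: enum_uniq.
have : (#|[set x | chi f.[x] == e]| <= #|A| + #|[set x | root D x]|)%N.
  apply: leq_trans (leq_card_setU _ _); apply: subset_leq_card.
  by apply/subsetP => x; rewrite !inE => ->; case: (root D x).
lia.
Qed.

(** Each sign occurs at most [5 p / 8 + O(1)] times and both together at least [p - 3] times, so
    their counts differ by at most [p / 4 + O(1)]. *)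
Lemma sum_chi_cubic_poly : `|\sum_x chi f.[x]| * 4 <= p%:Z + 60.
Proof.
have h1 := @card_cubic_chi 1 erefl; have h2 := @card_cubic_chi (-1) erefl.
have h0 : (#|[set x | root f x]| < 4)%N.
  rewrite cardE; have /eq_leq := size_cubic; apply: leq_trans.
  apply: max_poly_roots.
  - by rewrite -size_poly_gt0 size_cubic.
  - by apply/allP => x; rewrite mem_enum inE.
  exact: enum_uniq.
have hs : \sum_x chi f.[x] =
    #|[set x | chi f.[x] == 1]|%:Z - #|[set x | chi f.[x] == -1]|%:Z.
  rewrite -!sum_natr_card -sumrB; apply: eq_bigr => x _; rewrite /chi.
  by case: (f.[x] == 0) => //; case: (_ == 1).
have ht : p%:Z = #|[set x | chi f.[x] == 1]|%:Z
    + #|[set x | chi f.[x] == -1]|%:Z + #|[set x | root f x]|%:Z.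
  rewrite -!sum_natr_card -!big_split /= -cardF -cardsT -sum_natr_card.
  apply: eq_bigr => x _; rewrite /chi /root.
  by case: (f.[x] == 0) => //; case: (_ == 1).
rewrite hs; lia.
Qed.

End CubicSum.

Lemma sum_chi_cubic (p : nat) (F : finFieldType) (a b c d : F) :
  p \in [pchar F] -> #|F| = p -> (p %% 4 = 3)%N -> (3 < p)%N -> a != 0 ->
  `|\sum_x chi (a * x ^+ 3 + b * x ^+ 2 + c * x + d)| * 4 <= p%:Z + 60.
Proof.
move=> charF cardF p3 p_gt3 a0.
have := sum_chi_cubic_poly charF cardF p3 p_gt3 b c d a0.
congr (`|_| * _ <= _); apply: eq_bigr => x _; congr (chi _).
transitivity (((a * x + b) * x + c) * x + d); last by ring.
by rewrite /= !cons_poly_def !hornerE.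
Qed.

(** * Adjacency of maximal traces *)

Section Expansion.

Variables (p : nat) (F : finFieldType).
Hypothesis charF : p \in [pchar F].
Hypothesis cardF : #|F| = p.
Hypothesis p3mod4 : (p %% 4 = 3)%N.

Let chiMF := chiM charF cardF p3mod4.

Lemma chi_le1 (x : F) : chi x <= 1.
Proof. by have := chi_bound x; lia. Qed.

Lemma sum_chi_scaled_quadratic (c a b : F) :
  a != b -> \sum_x chi (c * ((x - a) * (x - b))) = - chi c.
Proof.
move=> ab; under eq_bigr => x _ do rewrite chiMF.
by rewrite -mulr_sumr (sum_chi_quadratic charF cardF p3mod4 ab) mulrN1.
Qed.

(* The rows of the matrix [chi (a * y - e)] are almost orthogonal. *)
Lemma leq_card_mul_nonsquare (A B : {set F}) (e : F) :
  e != 0 -> {in A, forall a, chi a = -1} ->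
  {in A & B, forall a b, chi (a * b - e) = -1} -> (#|A| * #|B| <= p)%N.
Proof.
move=> e0 hA hAB; have [->|A0] := posnP #|A|; first by rewrite mul0n.
pose G y := (\sum_(a in A) chi (a * y - e)) ^+ 2.
have hB : (#|A| ^ 2 * #|B|)%N%:Z <= \sum_y G y.
  have -> : (#|A| ^ 2 * #|B|)%N%:Z = \sum_(y in B) (#|A|%:Z ^+ 2).
    by rewrite sumr_const -mulr_natl natz; lia.
  rewrite [leRHS](bigID (mem B)) /= -[leLHS]addr0; apply: lerD; last first.
    by apply: sumr_ge0 => y _; apply: sqr_ge0.
  apply: ler_sum => y yB; rewrite /G (eq_bigr (fun=> -1)).
    by rewrite sumr_const -mulr_natl natz mulrN1 sqrrN.
  by move=> a aA; rewrite hAB.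
(* After expanding the square, a diagonal term is at most [p] and an off-diagonal one is
   [- chi (a * b) = -1]. *)
have hs : \sum_y G y <= (#|A| * p)%N%:Z.
  have -> : \sum_y G y = \sum_(a in A) \sum_(b in A)
      \sum_y chi ((a * y - e) * (b * y - e)).
    under [RHS]eq_bigr => a _ do rewrite exchange_big /=.
    rewrite [RHS]exchange_big /=; apply: eq_bigr => y _.
    rewrite /G expr2 big_distrlr /=; apply: eq_bigr => a _.
    by apply: eq_bigr => b _; rewrite chiMF.
  have -> : (#|A| * p)%N%:Z = \sum_(a in A) p%:Z.
    by rewrite sumr_const -mulr_natl natz; lia.
  apply: ler_sum => a aA; rewrite (bigD1 a) //= -[leRHS]addr0; apply: lerD.
    rewrite -cardF -cardsT -sum_natr_card; apply: ler_sum => y _; exact: chi_le1.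
  apply: sumr_le0 => b /andP[bA ba].
  have nz x : x \in A -> x != 0.
    by move=> xA; rewrite -chi_eq0 hA.
  rewrite (eq_bigr (fun y => chi ((a * b) * ((y - e / a) * (y - e / b))))).
    rewrite sum_chi_scaled_quadratic ?chiMF ?hA //.
    apply: contraNneq ba => /(mulfI e0) /invr_inj ->; exact: eqxx.
  by move=> y _; congr (chi _); field; rewrite !nz.
have := le_trans hB hs; nia.
Qed.

Definition maximal (t : F) : bool := (chi (t - 2) == 1) && (chi (t + 2) == -1).

(** The discriminant of [z^2 - t u z + t^2 + u^2], written through [t^2 - 4] and [u^2 - 4]. *)
Definition cross_disc (t u : F) : F := (t ^+ 2 - 4) * (u ^+ 2 - 4) - 16.

Definition maximal_nbhd (t : F) : {set F} :=
  [set u | maximal u && (0 <= chi (cross_disc t u))].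

Lemma maximal_disc t : maximal t -> chi (t ^+ 2 - 4) = -1.
Proof.
case/andP=> /eqP h1 /eqP h2; have -> : t ^+ 2 - 4 = (t - 2) * (t + 2) by ring.
by rewrite chiMF h1 h2.
Qed.

(** [W] weights each neighbour by 4 or 8 and all else by 0; expanding its product gives eight
    character sums. *)
Lemma card_maximal_nbhd t : (3 < p)%N -> maximal t -> t != 0 ->
  p%:Z <= 32 * #|maximal_nbhd t|%:Z + 176.
Proof.
move=> p_gt3 tm t0; have hA := maximal_disc tm.
have A0 : t ^+ 2 - 4 != 0 by rewrite -chi_eq0 hA.
have two0 := two_neq0 charF cardF p3mod4.
have four0 : 4 != 0 :> F by rewrite (natrX _ 2 2) expf_neq0.
set f := cross_disc t.
pose W := \sum_(u : F) (1 + chi (u - 2)) * (1 - chi (u + 2)) * (1 + chi (f u)).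
have Wle : W <= 8 * #|maximal_nbhd t|%:Z.
  have -> : 8 * #|maximal_nbhd t|%:Z =
      \sum_(u : F) 8 * ((maximal u && (0 <= chi (f u)))%:R : int).
    by rewrite -mulr_sumr sum_natr_card.
  apply: ler_sum => u _.
  (* At [u = 2] and [u = -2] the weight is 0, because 4 is a square and -4 is not. *)
  have [u2|u2] := eqVneq (u - 2) 0.
    have -> : u + 2 = 2 ^+ 2 by rewrite -[RHS]add0r -u2; ring.
    by rewrite (chi_sqr charF cardF p3mod4) // subrr mulr0 mul0r mulr_ge0.
  have [v2|v2] := eqVneq (u + 2) 0.
    have -> : u - 2 = - 2 ^+ 2 by rewrite -[LHS]subr0 -v2; ring.
    by rewrite (chiN charF cardF p3mod4) (chi_sqr charF cardF p3mod4) //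
      addrN !mul0r mulr_ge0.
  rewrite /maximal; have [->|->] := chi_cases u2; last by rewrite !mul0r mulr_ge0.
  have [->|->] := chi_cases v2; first by rewrite subrr mulr0 mul0r mulr_ge0.
  by rewrite /=; move: (chi_le1 (f u)) (chi_bound (f u)); case: lerP; lia.
have WE : W = p%:Z + \sum_(u : F) chi (u - 2) - \sum_(u : F) chi (u + 2)
    - \sum_(u : F) chi ((u - 2) * (u - - 2)) + \sum_(u : F) chi (f u)
    + \sum_(u : F) chi ((u - 2) * f u) - \sum_(u : F) chi ((u + 2) * f u)
    - \sum_(u : F) chi ((u ^+ 2 - 4) * f u).
  have -> : p%:Z = \sum_(u : F) 1.
    by rewrite sumr_const -mulr_natl mulr1 natz cardF.
  rewrite /W (eq_bigr (fun u => 1 + chi (u - 2) + - chi (u + 2)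
    + - chi ((u - 2) * (u - - 2)) + chi (f u) + chi ((u - 2) * f u)
    + - chi ((u + 2) * f u) + - chi ((u ^+ 2 - 4) * f u))).
    by rewrite !big_split /= !sumrN.
  move=> u _; have -> : u ^+ 2 - 4 = (u - 2) * (u + 2) by ring.
  by rewrite opprK !chiMF; ring.
have c1 : `|\sum_(u : F) chi ((u - 2) * f u)| * 4 <= p%:Z + 60.
  have := sum_chi_cubic (- 2 * (t ^+ 2 - 4)) (- 4 * t ^+ 2) (8 * t ^+ 2)
    charF cardF p3mod4 p_gt3 A0.
  congr (`|_| * _ <= _); apply: eq_bigr => u _; congr (chi _).
  by rewrite /f /cross_disc; ring.
have c2 : `|\sum_(u : F) chi ((u + 2) * f u)| * 4 <= p%:Z + 60.
  have := sum_chi_cubic (2 * (t ^+ 2 - 4)) (- 4 * t ^+ 2) (- 8 * t ^+ 2)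
    charF cardF p3mod4 p_gt3 A0.
  congr (`|_| * _ <= _); apply: eq_bigr => u _; congr (chi _).
  by rewrite /f /cross_disc; ring.
pose s := 4 * t ^+ 2 / (t ^+ 2 - 4).
have s0 : s != 0 by rewrite /s !mulf_neq0 ?invr_eq0 ?expf_neq0.
have sE u : f u = (t ^+ 2 - 4) * (u ^+ 2 - s).
  by rewrite /f /cross_disc /s; field.
have q1 : \sum_(u : F) chi (f u) = 1.
  under eq_bigr => u _ do rewrite sE chiMF.
  by rewrite -mulr_sumr (sum_chi_sqrB charF cardF p3mod4 s0) hA.
have s4 : 4 != s.
  rewrite -subr_eq0 (_ : 4 - s = - (2 ^+ 4) / (t ^+ 2 - 4)).
    by rewrite mulf_neq0 ?invr_eq0 ?oppr_eq0 ?expf_neq0.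
  by rewrite /s; field.
(* The quartic is even in [u]: with [v = u ^+ 2] it becomes a quadratic sum equal to 1 plus a cubic
   sum. *)
have q2 : `|\sum_(u : F) chi ((u ^+ 2 - 4) * f u)| * 4 <= p%:Z + 64.
  pose g v := (t ^+ 2 - 4) * ((v - 4) * (v - s)).
  rewrite (eq_bigr (fun u => chi (g (u ^+ 2)))); last first.
    by move=> u _; rewrite sE /g; congr (chi _); ring.
  rewrite (sum_sqr charF cardF p3mod4 (fun v => chi (g v))).
  under eq_bigr => v _ do rewrite mulrDl mul1r -chiMF.
  rewrite big_split /= sum_chi_scaled_quadratic // hA.
  have := sum_chi_cubic (- (t ^+ 2 - 4) * (4 + s)) ((t ^+ 2 - 4) * (4 * s)) 0
    charF cardF p3mod4 p_gt3 A0.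
  rewrite (eq_bigr (fun v => chi (v * g v))) => [|v _]; last first.
    by congr (chi _); rewrite /g; ring.
  by move: (\sum_(v : F) _) => z; lia.
have q3 : \sum_(u : F) chi ((u - 2) * (u - - 2)) = -1.
  apply: (sum_chi_quadratic charF cardF p3mod4).
  by rewrite -subr_eq0 opprK -(natrD _ 2 2).
have l1 : \sum_(u : F) chi (u - 2) = 0.
  rewrite -[RHS](@sum_chi_affine _ _ charF cardF p3mod4 1 (- 2)) ?oner_eq0 //.
  by apply: eq_bigr => u _; rewrite mul1r.
have l2 : \sum_(u : F) chi (u + 2) = 0.
  rewrite -[RHS](@sum_chi_affine _ _ charF cardF p3mod4 1 2) ?oner_eq0 //.
  by apply: eq_bigr => u _; rewrite mul1r.
(* [W >= p + 2 - 2 (p + 60) / 4 - (p + 64) / 4 = p / 4 - 44]. *)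
move: WE Wle c1 c2 q2; rewrite q1 q3 l1 l2.
move: (\sum_(u : F) chi ((u - 2) * f u)) (\sum_(u : F) chi ((u + 2) * f u))
  (\sum_(u : F) chi ((u ^+ 2 - 4) * f u)) => z1 z2 z3; lia.
Qed.

End Expansion.

(** * Orders of rotations *)

Section Rotation.

Variables (p : nat) (F : finFieldType).
Hypothesis charF : p \in [pchar F].
Hypothesis cardF : #|F| = p.
Hypothesis p3mod4 : (p %% 4 = 3)%N.

Let two0 : 2 != 0 :> F := two_neq0 charF cardF p3mod4.
Let chiMF := chiM charF cardF p3mod4.

Definition rotation (t : F) : 'M[F]_2 :=
  \matrix_(i, j) nth 0 (nth [::] [:: [:: 0; 1]; [:: -1; t]] i) j.

Definition rotation_poly (t : F) : {poly F} := 'X ^+ 2 - t%:P * 'X + 1.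

Lemma rotation_root t : horner_mx (rotation t) (rotation_poly t) = 0.
Proof.
rewrite /rotation_poly rmorphD rmorphB rmorphXn rmorphM /=.
rewrite horner_mx_X horner_mx_C rmorph1 expr2.
apply/matrixP => i j; rewrite !mxE !big_ord_recl !big_ord0 !mxE /=.
by case: i => [[|[|//]]] ?; case: j => [[|[|//]]] ?; rewrite /= ?mulr1n ?mulr0n; ring.
Qed.

(** Powers of the rotation are hereby computed as powers of ['X] modulo its characteristic
    polynomial. *)
Lemma rotation_congr t (a b : {poly F}) : rotation_poly t %| a - b ->
  horner_mx (rotation t) a = horner_mx (rotation t) b.
Proof.
case/dvdpP => q /(congr1 (horner_mx (rotation t))).
by rewrite rmorphM /= rotation_root mulr0 rmorphB => /eqP; rewrite subr_eq0 => /eqP.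
Qed.

Lemma dvdp_subXX (m a b : {poly F}) k : m %| a - b -> m %| a ^+ k - b ^+ k.
Proof. by move=> h; rewrite subrXX dvdp_mulr. Qed.

Lemma poly_frobeniusD (a b : {poly F}) : (a + b) ^+ p = a ^+ p + b ^+ p.
Proof.
by apply: exprDn_pchar; rewrite pnatE ?(pcharf_prime charF) // pchar_poly.
Qed.

Lemma poly_frobeniusC (a : F) : a%:P ^+ p = a%:P :> {poly F}.
Proof. by rewrite -rmorphXn -cardF /= expf_card. Qed.

Lemma card_halfE : p = (#|F|.-1)./2.*2.+1.
Proof. rewrite cardF; lia. Qed.

(* Completing the square, [(2 X - t) ^+ 2 = t ^+ 2 - 4] modulo the
   characteristic polynomial. *)
Lemma rotation_frobenius t : rotation_poly t %|
  2 * 'X ^+ p - t%:P - ((chi (t ^+ 2 - 4))%:~R)%:P * (2 * 'X - t%:P).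
Proof.
have -> : 2 * 'X ^+ p - t%:P = (2 * 'X - t%:P) ^+ p :> {poly F}.
  rewrite poly_frobeniusD -polyCN poly_frobeniusC exprMn.
  by rewrite -[2 in RHS](rmorph_nat (@polyC F) 2) poly_frobeniusC rmorph_nat.
rewrite (chi_expr charF cardF p3mod4) rmorphXn /= {1}card_halfE exprS -muln2 mulnC exprM.
rewrite [X in _ - X]mulrC -mulrBr dvdp_mull // dvdp_subXX //.
apply/dvdpP; exists 4; rewrite /rotation_poly rmorphB rmorphXn /=.
by rewrite (rmorph_nat (@polyC F) 4); ring.
Qed.

Lemma dvdp_mulCl (c : F) (m a : {poly F}) : c != 0 -> m %| c%:P * a -> m %| a.
Proof. by move=> c0; rewrite mul_polyC dvdpZr. Qed.

(** With a nonsquare discriminant, Frobenius exchanges the eigenvalues ['X] and [t - 'X]. *)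
Lemma rotation_frobenius_elliptic t : chi (t ^+ 2 - 4) = -1 ->
  rotation_poly t %| 'X ^+ p - (t%:P - 'X).
Proof.
move=> ht; have := rotation_frobenius t; rewrite ht => h.
apply: (dvdp_mulCl two0); move: h; congr (_ %| _).
by rewrite mulrN1z polyCN polyC1 (rmorph_nat (@polyC F) 2); ring.
Qed.

(** Modulo [rotation_poly t], [(t + 2) 'X = ('X + 1)^2]. Raised to the power [(p + 1) / 2], the
    right side becomes [('X + 1) (t - 'X + 1) = t + 2]. *)
Lemma rotation_half_order t : chi (t ^+ 2 - 4) = -1 ->
  rotation t ^+ (p.+1)./2 = (chi (t + 2))%:~R%:M.
Proof.
move=> ht; have frob := rotation_frobenius_elliptic ht.
have t2 : t + 2 != 0.
  rewrite -chi_eq0; have : chi (t ^+ 2 - 4) != 0 by rewrite ht.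
  have -> : t ^+ 2 - 4 = (t - 2) * (t + 2) by ring.
  by rewrite chiMF mulf_eq0 negb_or => /andP[].
rewrite -[rotation t in LHS]horner_mx_X -rmorphXn -(horner_mx_C (rotation t)).
apply: rotation_congr; apply: (dvdp_mulCl t2).
pose a : {poly F} := (t + 2)%:P * 'X.
have h1 : rotation_poly t %| a ^+ (p.+1)./2 - (('X + 1) ^+ 2) ^+ (p.+1)./2.
  apply: dvdp_subXX; apply/dvdpP; exists (-1).
  by rewrite /a /rotation_poly rmorphD (rmorph_nat (@polyC F) 2); ring.
have h2 : rotation_poly t %| (('X + 1) ^+ 2) ^+ (p.+1)./2 - (t + 2)%:P.
  rewrite -exprM (_ : (2 * (p.+1)./2 = p.+1)%N); last by lia.
  rewrite exprS poly_frobeniusD expr1n.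
  have [q hq] := dvdpP _ _ frob; apply/dvdpP; exists (('X + 1) * q - 1).
  have -> : 'X ^+ p = q * rotation_poly t + (t%:P - 'X) by rewrite -hq subrK.
  by rewrite /rotation_poly rmorphD (rmorph_nat (@polyC F) 2); ring.
have := dvdp_add h1 h2; rewrite addrA subrK /a exprMn.
rewrite (chi_expr charF cardF p3mod4) cardF.
have -> : (p.+1)./2 = ((p.-1)./2).+1 by lia.
move=> h3; have t2p : ((t + 2) ^+ (p.-1)./2 = 1) \/ ((t + 2) ^+ (p.-1)./2 = -1).
  by have := expr_half charF cardF p3mod4 t2; rewrite cardF => /orP[]/eqP; [left|right].
move: h3; rewrite exprS -!rmorphXn /=; case: t2p => ->; rewrite ?mulr1 ?mulrN1.
  by rewrite polyC1 mulrBr mulr1.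
by move=> h3; rewrite -dvdpNr; move: h3; congr (_ %| _); rewrite !polyCN polyC1; ring.
Qed.

Lemma rotation_order_elliptic t : chi (t ^+ 2 - 4) = -1 -> rotation t ^+ p.+1 = 1.
Proof.
move=> ht; rewrite (_ : (p.+1 = (p.+1)./2 * 2)%N); last by lia.
rewrite exprM rotation_half_order // -rmorphXn -rmorphXn /=.
rewrite /chi; case: eqP => [t2|_]; last by case: eqP; rewrite ?expr1n ?sqrrN ?expr1n.
have e : t ^+ 2 - 4 = (t - 2) * (t + 2) by ring.
by move: ht; rewrite e t2 mulr0 chi0.
Qed.

Lemma rotation_unit t : rotation t \is a GRing.unit.
Proof.
rewrite -[_ \is a _]/(rotation t \in unitmx) unitmxE.
rewrite (expand_det_row _ ord0) !big_ord_recl big_ord0 /cofactor !det_mx11.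
by rewrite !mxE /= mul0r mul1r expr1 mulrN1 opprK add0r addr0 unitr1.
Qed.

Lemma rotation_order_hyperbolic t : chi (t ^+ 2 - 4) = 1 -> rotation t ^+ p.-1 = 1.
Proof.
move=> ht; have := rotation_frobenius t; rewrite ht => h.
apply: (mulrI (rotation_unit t)); rewrite mulr1 -exprS prednK; last by lia.
rewrite -[rotation t]horner_mx_X -rmorphXn.
apply: rotation_congr; apply: (dvdp_mulCl two0); move: h; congr (_ %| _).
by rewrite polyC1 (rmorph_nat (@polyC F) 2); ring.
Qed.

Lemma rotation2_order : rotation 2 ^+ p = 1.
Proof.
rewrite -[rotation 2]horner_mx_X -rmorphXn -(rmorph1 (horner_mx (rotation 2))).
apply: rotation_congr; apply: (dvdp_mulCl two0).
have := rotation_frobenius 2.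
rewrite (_ : 2 ^+ 2 - 4 = 0); last by ring.
rewrite chi0 polyC0 mul0r subr0; congr (_ %| _).
by rewrite (rmorph_nat (@polyC F) 2); ring.
Qed.

End Rotation.

(** * Transitivity on conics *)

Section Conic.

Variables (p : nat) (F : finFieldType).
Hypothesis charF : p \in [pchar F].
Hypothesis cardF : #|F| = p.
Hypothesis p3mod4 : (p %% 4 = 3)%N.

Let two0 : 2 != 0 :> F := two_neq0 charF cardF p3mod4.
Let four0 : 4 != 0 :> F.
Proof. by rewrite (natrX _ 2 2) expf_neq0. Qed.
Let chiMF := chiM charF cardF p3mod4.

Lemma one_neqN1 : 1 != -1 :> F.
Proof. by rewrite -subr_eq0 opprK. Qed.

(* A square root of 5 yields [r] with [r ^+ 2 + r - 1 = 0], and the rotation of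
   trace [r] then has order 5, whereas 5 does not divide [p ^ 2 - 1]. *)
Lemma chi5 : (5 < p)%N -> (p %% 5 = 2)%N \/ (p %% 5 = 3)%N -> chi (5 : F) = -1.
Proof.
move=> p_gt5 p5; apply: (chi_lt0 charF cardF p3mod4) => s; apply/eqP => s5.
pose r : F := (s - 1) / 2.
have r_eq : r ^+ 2 + r - 1 = 0.
  have -> : r ^+ 2 + r - 1 = (s ^+ 2 - 5) / 4 by rewrite /r; field; rewrite ?two0 ?four0.
  by rewrite s5 subrr mul0r.
have M5 : rotation r ^+ 5 = 1.
  rewrite -[rotation r]horner_mx_X -rmorphXn -(rmorph1 (horner_mx (rotation r))).
  apply: rotation_congr; apply/dvdpP.
  (* As [r (r + 1) = 1], the fifth cyclotomic polynomial is [('X^2 - r 'X + 1) ('X^2 + (r + 1) 'X +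
     1)]. *)
  exists (('X - 1) * ('X ^+ 2 + (r + 1)%:P * 'X + 1)).
  have e : r%:P * (r + 1)%:P = 1 :> {poly F}.
    rewrite -rmorphM /= -polyC1; congr _%:P.
    by apply/eqP; rewrite -subr_eq0 -r_eq; apply/eqP; ring.
  have e2 : (r + 1)%:P = r%:P + 1 :> {poly F} by rewrite rmorphD.
  rewrite /rotation_poly.
  have -> : 'X ^+ 5 - 1 = ('X - 1) * ('X ^+ 4 + 'X ^+ 3
      + (2 - r%:P * (r + 1)%:P) * 'X ^+ 2 + 'X + 1) :> {poly F}.
    by rewrite e; ring.
  by rewrite e2; ring.
have M1 k : (k %% 5 != 0)%N -> rotation r ^+ k = 1 -> False.
  move=> k5 Mk.
  have [i [j ij]] : exists i j, (k * i = 5 * j + 1)%N.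
    have [e|e|e|e] : [\/ (k %% 5 = 1)%N, (k %% 5 = 2)%N, (k %% 5 = 3)%N
        | (k %% 5 = 4)%N].
      by case: (k %% 5)%N (ltn_pmod k (isT : 0 < 5)%N) k5 => [|[|[|[|[|]]]]] //;
        [constructor 1|constructor 2|constructor 3|constructor 4].
    - by exists 1%N, (k %/ 5)%N; lia.
    - by exists 3%N, (3 * (k %/ 5) + 1)%N; lia.
    - by exists 2%N, (2 * (k %/ 5) + 1)%N; lia.
    by exists 4%N, (4 * (k %/ 5) + 3)%N; lia.
  have : rotation r = 1.
    transitivity (rotation r ^+ (k * i)); last by rewrite exprM Mk expr1n.
    by rewrite ij addn1 exprSr exprM M5 expr1n mul1r.
  by move/matrixP => /(_ 0 0); rewrite !mxE /= => /eqP; rewrite eq_sym oner_eq0.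
(* At [r = 2] and [r = -2] the value of [r ^+ 2 + r - 1] is 5 and 1, neither of them 0. *)
have [r4|r4] := eqVneq (r ^+ 2 - 4) 0.
  have : (r - 2) * (r + 2) == 0 by rewrite -r4; apply/eqP; ring.
  have nz5 : 5 != 0 :> F by apply: (natr_neq0 charF).
  rewrite mulf_eq0 => /orP[] /eqP h.
    by case/eqP: nz5; rewrite -r_eq -[RHS]subr0 -[X in _ - X](mul0r (r + 3)) -h; ring.
  case/eqP: (oner_neq0 F).
  rewrite -[RHS]r_eq -[RHS]subr0 -[X in _ - X](mul0r (r - 1)) -h; ring.
case: (chi_cases r4) => h.
  apply: (@M1 p.-1); last exact: (rotation_order_hyperbolic charF cardF p3mod4).
  by lia.
apply: (@M1 p.+1); last exact: (rotation_order_elliptic charF cardF p3mod4).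
by lia.
Qed.

(** Otherwise the order divides [p] (if [t = 2]), [p - 1] (if [t^2 - 4] is a square) or
    [(p + 1) / 2] (if only [t + 2] is). *)
Lemma maximal_of_order (t : F) : t != -2 ->
  (forall k, (0 < k < p.+1)%N -> rotation t ^+ k != 1) -> maximal t.
Proof.
move=> t2 ord.
have e : t ^+ 2 - 4 = (t - 2) * (t + 2) by ring.
have tp2 : t + 2 != 0 by rewrite addr_eq0.
have ne k : (0 < k < p.+1)%N -> rotation t ^+ k = 1 -> False.
  by move=> hk h; have := ord k hk; rewrite h eqxx.
have tm2 : t - 2 != 0.
  rewrite subr_eq0; apply/eqP => t2'; apply: (@ne p); first by lia.
  by rewrite t2' (rotation2_order charF cardF p3mod4).
have t4 : t ^+ 2 - 4 != 0 by rewrite e mulf_neq0.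
have [h|h] := chi_cases t4.
  case: (@ne p.-1); first by lia.
  exact: (rotation_order_hyperbolic charF cardF p3mod4).
have hh := rotation_half_order charF cardF p3mod4 h.
have [h2|h2] := chi_cases tp2.
  by case: (@ne (p.+1)./2); [lia | rewrite hh h2].
rewrite /maximal h2 eqxx andbT.
by move: h; rewrite e chiMF h2; case: (chi_cases tm2) => ->.
Qed.

(** The fourth power of the rotation of trace 0 is 1 and 4 divides [(p + 1) / 2], whereas for
    maximal [t] the power [(p + 1) / 2] is -1. *)
Lemma maximal_neq0 (t : F) : (p %% 8 = 7)%N -> maximal t -> t != 0.
Proof.
move=> p7 tm; apply/eqP => t0.
have := rotation_half_order charF cardF p3mod4 (maximal_disc charF cardF p3mod4 tm).
case/andP: tm => _ /eqP ->; rewrite t0.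
have M4 : rotation (0 : F) ^+ 4 = 1.
  rewrite -[rotation 0]horner_mx_X -rmorphXn -(rmorph1 (horner_mx (rotation 0))).
  apply: rotation_congr; apply/dvdpP; exists ('X ^+ 2 - 1).
  by rewrite /rotation_poly polyC0; ring.
rewrite (_ : (p.+1)./2 = (4 * (p.+1 %/ 8))%N); last by lia.
rewrite exprM M4 expr1n => /matrixP/(_ 0 0); rewrite !mxE /= => /eqP.
by rewrite (negPf one_neqN1).
Qed.

Definition surface (x y z : F) : bool := x ^+ 2 + y ^+ 2 + z ^+ 2 == x * y * z.

Definition conic (t : F) : {set F * F} := [set v | surface t v.1 v.2].

(** The Vieta move replacing the first entry by the other root, followed by a swap. *)
Definition rot_step (t : F) (v : F * F) : F * F := (v.2, t * v.2 - v.1).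

Lemma rot_step_inj t : injective (rot_step t).
Proof.
move=> [a b] [c d]; rewrite /rot_step /= => -[-> /eqP].
by rewrite (inj_eq (addrI _)) eqr_opp => /eqP ->.
Qed.

Lemma rot_step_conic t v : (rot_step t v \in conic t) = (v \in conic t).
Proof.
rewrite !inE /surface /rot_step /= -subr_eq0 -[RHS]subr_eq0; congr (_ == 0); ring.
Qed.

Lemma iter_rot_step_conic t k v : (iter k (rot_step t) v \in conic t) = (v \in conic t).
Proof. by elim: k => //= k IH; rewrite rot_step_conic. Qed.

Lemma surface_chi x y :
  (exists z, surface x y z) <-> 0 <= chi (cross_disc x y).
Proof.
have sq z : (2 * z - x * y) ^+ 2 = cross_disc x y
    + 4 * (x ^+ 2 + y ^+ 2 + z ^+ 2 - x * y * z).
  by rewrite /cross_disc; ring.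
split=> [[z /eqP h]|/(chi_ge0_sqrt charF cardF p3mod4) [w hw]].
  move: (sq z); rewrite h subrr mulr0 addr0 => <-.
  have [->|n0] := eqVneq (2 * z - x * y) 0; first by rewrite expr0n chi0.
  by rewrite (chi_sqr charF cardF p3mod4).
exists ((w + x * y) / 2); have := sq ((w + x * y) / 2).
rewrite (_ : 2 * _ - _ = w); last by field.
rewrite hw -[LHS]addr0 => /addrI /esym /eqP.
by rewrite mulf_eq0 (negPf four0) subr_eq0.
Qed.

(** Completing the square, the fibre over [y] has [1 + chi ((t^2 - 4) (y^2 - s))] points. *)
Lemma card_conic t : maximal t -> t != 0 -> #|conic t| = p.+1.
Proof.
move=> tm t0; have hA := maximal_disc charF cardF p3mod4 tm.
have A0 : t ^+ 2 - 4 != 0 by rewrite -chi_eq0 hA.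
pose s := 4 * t ^+ 2 / (t ^+ 2 - 4).
have s0 : s != 0 by rewrite /s !mulf_neq0 ?invr_eq0 ?expf_neq0.
apply/eqP; rewrite -eqz_nat; apply/eqP.
rewrite -sum_natr_card /=.
rewrite -(pair_bigA _ (fun y z => ((surface t y z)%:R : int))) /=.
transitivity (\sum_(y : F) (1 + chi (t ^+ 2 - 4) * chi (y ^+ 2 - s))); last first.
  rewrite big_split /= -mulr_sumr (sum_chi_sqrB charF cardF p3mod4 s0) hA.
  by rewrite sumr_const -mulr_natl mulr1 natz cardF; lia.
apply: eq_bigr => y _; rewrite -chiMF -(card_sqrt charF cardF p3mod4) sum_natr_card.
congr Posz; rewrite -(@card_imset _ _ (fun z => 2 * z - t * y)) => [|a b].
  apply: eq_card => w; rewrite !inE; apply/imsetP/eqP => [[z]|h].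
    rewrite inE => /eqP h ->.
    have -> : (2 * z - t * y) ^+ 2 = (t ^+ 2 * y ^+ 2 - 4 * y ^+ 2 - 4 * t ^+ 2)
      + 4 * (t ^+ 2 + y ^+ 2 + z ^+ 2 - t * y * z) by ring.
    by rewrite h /s; field.
  exists ((w + t * y) / 2); last by field.
  rewrite inE /surface -subr_eq0.
  have -> : t ^+ 2 + y ^+ 2 + ((w + t * y) / 2) ^+ 2 - t * y * ((w + t * y) / 2)
    = (w ^+ 2 - (t ^+ 2 - 4) * (y ^+ 2 - s)) / 4.
    by rewrite /s; field; rewrite A0 two0 four0.
  by rewrite h subrr mul0r.
by move/addIr/(mulfI two0).
Qed.

Definition vec (v : F * F) : 'cV[F]_2 := \col_i nth 0 [:: v.1; v.2] i.

Lemma vec_iter t k v : vec (iter k (rot_step t) v) = rotation t ^+ k *m vec v.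
Proof.
elim: k => [|k IH]; first by rewrite expr0 mul1mx.
rewrite exprS -mulmxA -IH /=; move: (iter k _ v) => w.
apply/matrixP => i j; rewrite !mxE !big_ord_recl big_ord0 !mxE /=.
by case: i => [[|[|//]]] ? /=; ring.
Qed.

Lemma vec_inj : injective vec.
Proof.
move=> [a b] [c d] /matrixP h; have := h 0 0; have := h 1 0.
by rewrite !mxE /= => -> ->.
Qed.

(* [rotation t ^+ (2 ^ n.-1) = -1], so that no nonzero vector has a period
   properly dividing [2 ^ n = p + 1]; hence an orbit fills the conic. *)
Lemma rot_step_transitive n t v w : (2 ^ n = p.+1)%N -> maximal t -> t != 0 ->
  v \in conic t -> w \in conic t -> exists k, w = iter k (rot_step t) v.
Proof.
move=> n2 tm t0 vt wt; have hA := maximal_disc charF cardF p3mod4 tm.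
set r := rot_step t; have rI : injective r := @rot_step_inj t.
have Hfull : iter (2 ^ n) r v = v.
  apply: vec_inj; rewrite vec_iter n2.
  by rewrite (rotation_order_elliptic charF cardF p3mod4 hA) mul1mx.
have Hhalf : iter (2 ^ n.-1) r v <> v.
  move=> /(congr1 vec); rewrite vec_iter.
  have -> : (2 ^ n.-1 = (p.+1)./2)%N.
    by rewrite -n2; case: (n) n2 => [|k] /=; rewrite ?expn0 ?expnS; lia.
  rewrite (rotation_half_order charF cardF p3mod4 hA).
  (* The half-turn negates [v], so a fixed [v] would be [(0, 0)], which is off the conic because
     [t != 0]. *)
  case/andP: tm => _ /eqP ->; rewrite mul_scalar_mx mulrN1z scaleN1r => /eqP.
  rewrite eq_sym -subr_eq0 opprK -mulr2n -scaler_nat scaler_eq0 (negPf two0) /= => /eqP.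
  rewrite (_ : 0 = vec (0, 0)); last first.
    by apply/matrixP => i j; rewrite !mxE; case: i => [[|[|//]]].
  move=> /vec_inj v0; move: vt; rewrite v0 inE /surface /= expr0n !addr0 !mulr0.
  by rewrite sqrf_eq0 (negPf t0).
have ordv : iter (fingraph.order r v) r v = v := iter_order rI v.
have iterM k m : iter m r v = v -> iter (k * m) r v = v.
  by move=> h; elim: k => // k IH; rewrite mulSn iterD IH.
have dv : (fingraph.order r v %| 2 ^ n)%N.
  rewrite /dvdn; apply/negPn/negP => nz.
  have : iter (2 ^ n %% fingraph.order r v) r v = v.
    have := Hfull; rewrite {1}(divn_eq (2 ^ n) (fingraph.order r v)) addnC.
    by rewrite iterD iterM.
  move/(congr1 (findex r v)); rewrite findex_iter ?ltn_mod ?order_gt0 // findex0.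
  by move/eqP; rewrite (negPf nz).
have ordE : fingraph.order r v = p.+1.
  have [m] := dvdn_pfactor _ n (isT : prime 2) dv.
  rewrite leq_eqVlt => /orP[/eqP -> -> //|mn om]; case: Hhalf.
  rewrite (_ : (n.-1 = n.-1 - m + m)%N); last by lia.
  by rewrite expnD iterM // -om.
have sub : fingraph.orbit r v \subset conic t.
  apply/subsetP => u; rewrite -fconnect_orbit => /iter_findex <-.
  by rewrite iter_rot_step_conic.
have cE : #|fingraph.orbit r v| = #|conic t|.
  by rewrite (card_uniqP (orbit_uniq r v)) size_orbit ordE card_conic.
have /(_ w) := elimT (subset_cardP cE) sub.
rewrite wt -fconnect_orbit => /iter_findex <-.
by exists (findex r v w).
Qed.

End Conic.

(** * Connectivity of maximal traces *)

Definition squares_mod (p : nat) : seq nat :=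
  undup [seq (k * k %% p)%N | k <- iota 0 p].

(* The residue [s] stands for the trace [t = s + 2]. *)
Definition maximal_mod (p : nat) (sqs : seq nat) : seq nat :=
  [seq s <- sqs | (s != 0)%N &&
    has (fun r => (r != 0)%N && ((s + r + 4) %% p == 0)%N) sqs].

(** [disc s] is [t^2 - 4] for [t = s + 2]; adding 16 to the squares avoids truncated subtraction. *)
Definition adjacent_mod (p : nat) (sqs : seq nat) (a b : nat) : bool :=
  let disc s := (s * (s + 4) %% p)%N in
  (disc a * disc b %% p)%N \in [seq (w + 16) %% p | w <- sqs]%N.

(* Every maximal trace is joined to 3 through one of the hubs. *)
Definition hubs_mod (p : nat) (hubs : seq nat) : bool :=
  let sqs := squares_mod p in
  let traces := maximal_mod p sqs in
  all (fun b => (b \in traces) && adjacent_mod p sqs 1 b) hubs &&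
  all (fun a => has (fun b => adjacent_mod p sqs b a) hubs) traces.

(** The hub 1 is the trace 3, adjacent to itself as [5 * 5 - 16 = 3^2]. *)
Lemma hubs_mod7 : hubs_mod 7 [:: 1%N].
Proof. by vm_compute. Qed.

Lemma hubs_mod127 : hubs_mod 127 [:: 1; 16; 49]%N.
Proof. by vm_compute. Qed.

Section Reachability.

Variables (p : nat) (F : finFieldType).
Hypothesis charF : p \in [pchar F].
Hypothesis cardF : #|F| = p.
Hypothesis p3mod4 : (p %% 4 = 3)%N.

Let two0 : 2 != 0 :> F := two_neq0 charF cardF p3mod4.
Let chiMF := chiM charF cardF p3mod4.

Definition adjacent (t u : F) : bool := u \in maximal_nbhd t.

Lemma natr_modp n : (n %% p)%:R = n%:R :> F.
Proof. by rewrite [in RHS](divn_eq n p) natrD natrM (pcharf0 charF) mulr0 add0r. Qed.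

Lemma natr_surj (x : F) : exists2 k, (k < p)%N & x = k%:R.
Proof.
have fI : injective (fun i : 'I_p => i%:R : F).
  move=> i j h; apply: val_inj => /=; move: h.
  wlog ij : i j / (i <= j)%N.
    by move=> W; case/orP: (leq_total i j) => [/W//|/W e /esym /e].
  move=> /esym/eqP; rewrite -subr_eq0 -natrB // -(dvdn_pcharf charF) => /dvdn_leq.
  by have := ltn_ord j; lia.
have [|g fg gf] := inj_card_bij fI; first by rewrite card_ord cardF.
by exists (g x) => //; rewrite -[LHS]gf.
Qed.

Lemma squares_modP s : s \in squares_mod p ->
  (s < p)%N /\ exists y : F, s%:R = y ^+ 2.
Proof.
rewrite mem_undup => /mapP[k]; rewrite mem_iota => /andP[_ kp] ->; split.
  by rewrite ltn_mod; lia.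
by exists k%:R; rewrite natr_modp natrM.
Qed.

Lemma mem_squares_mod (y : F) : exists2 s, s \in squares_mod p & y ^+ 2 = s%:R.
Proof.
have [k kp ->] := natr_surj y; exists (k * k %% p)%N; last by rewrite natr_modp natrM.
by rewrite mem_undup; apply: map_f; rewrite mem_iota.
Qed.

(** The witness [r] makes [- (t + 2)] a nonzero square, so [t + 2] is a nonsquare. *)
Lemma maximal_modP s : s \in maximal_mod p (squares_mod p) -> maximal (s%:R + 2 : F).
Proof.
rewrite mem_filter => /andP[/andP[s0 /hasP[r rS /andP[r0 /eqP sr]]] sS].
have nz q : q \in squares_mod p -> (q != 0)%N -> chi (q%:R : F) = 1.
  move=> /squares_modP[qp [y qy]] q0.
  have qF : q%:R != 0 :> F by apply: (natr_neq0 charF); lia.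
  rewrite qy; apply: (chi_sqr charF cardF p3mod4).
  by apply: contraNneq qF => y0; rewrite qy y0 expr0n.
apply/andP; split; first by rewrite addrK nz.
have -> : s%:R + 2 + 2 = - r%:R :> F.
  apply/eqP; rewrite -subr_eq0 opprK.
  have : (s + r + 4)%:R = 0 :> F by rewrite -natr_modp sr.
  by rewrite !natrD => <-; apply/eqP; ring.
by rewrite (chiN charF cardF p3mod4) nz.
Qed.

Lemma mem_maximal_mod (t : F) : maximal t ->
  exists2 s, s \in maximal_mod p (squares_mod p) & t = s%:R + 2.
Proof.
case/andP=> /eqP h1 /eqP h2.
have [|y hy] := @chi_ge0_sqrt _ _ charF cardF p3mod4 (t - 2); first by rewrite h1.
have [|w hw] := @chi_ge0_sqrt _ _ charF cardF p3mod4 (- (t + 2)).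
  by rewrite (chiN charF cardF p3mod4) h2.
have [s sS sy] := mem_squares_mod y; have [r rS rw] := mem_squares_mod w.
have st : t = s%:R + 2 by rewrite -sy hy subrK.
have nz (q : nat) (x : F) : q%:R = x -> chi x != 0 -> (q != 0)%N.
  by move=> qx; rewrite chi_eq0 -qx; apply: contraNneq => ->.
exists s => //; rewrite mem_filter sS andbT; apply/andP; split.
  by apply: (nz _ (t - 2)); [rewrite -sy | rewrite h1].
apply/hasP; exists r => //; apply/andP; split.
  by apply: (nz _ (- (t + 2))); [rewrite -rw | rewrite (chiN charF cardF p3mod4) h2].
rewrite -/(p %| s + r + 4)%N (dvdn_pcharf charF) !natrD -rw hw st.
by apply/eqP; ring.
Qed.

Lemma adjacent_modP a b : adjacent_mod p (squares_mod p) a b ->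
  0 <= chi (cross_disc (a%:R + 2) (b%:R + 2) : F).
Proof.
case/mapP=> w /squares_modP[_ [y wy]] /(congr1 (fun k => k%:R : F)).
rewrite !natr_modp natrM !natr_modp !natrM !natrD => h.
have -> : cross_disc (a%:R + 2) (b%:R + 2) = y ^+ 2 :> F.
  by rewrite -wy -[RHS](addrK 16) -h /cross_disc; ring.
have [->|y0] := eqVneq y 0; first by rewrite expr0n chi0.
by rewrite (chi_sqr charF cardF p3mod4).
Qed.

Lemma connect_of_hubs hubs t : hubs_mod p hubs -> maximal t -> connect adjacent 3 t.
Proof.
case/andP=> /allP hb /allP ha tm.
have [a am ta] := mem_maximal_mod tm.
have /hasP[b bh ab] := ha _ am; have /andP[bm b1] := hb _ bh.
have three : 3 = 1%:R + 2 :> F by ring.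
apply: (@connect_trans _ _ (b%:R + 2)); apply: connect1; rewrite /adjacent inE.
  by rewrite maximal_modP //= three adjacent_modP.
by rewrite tm /= ta adjacent_modP.
Qed.

(** In [sum_sqr] every weight [1 + chi v] is at most 2. *)
Lemma leq_card_sqr_image (S : {set F}) (c : F) :
  (#|S| <= 2 * #|[set (u ^+ 2 - c)%R | u in S]|)%N.
Proof.
set I := [set _ | _ in _].
have h1 : #|S|%:Z <= \sum_(u : F) ((u ^+ 2 - c \in I)%:R : int).
  rewrite (_ : S = [set u | u \in S]); last by apply/setP => u; rewrite inE.
  rewrite -sum_natr_card; apply: ler_sum => u _.
  by case uS: (u \in S) => //; rewrite (imset_f (fun u => u ^+ 2 - c) uS).
have h2 : \sum_(u : F) ((u ^+ 2 - c \in I)%:R : int)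
    <= \sum_(v : F) 2 * ((v \in I)%:R : int).
  rewrite (sum_sqr charF cardF p3mod4 (fun v => (v - c \in I)%:R)).
  rewrite [leRHS](reindex_inj (addIr (- c))); apply: ler_sum => v _ /=.
  by have := chi_bound v; case: (v - c \in I); rewrite ?mulr0 ?mulr1 //; lia.
have := le_trans h1 h2; rewrite -mulr_sumr sum_natr_card.
rewrite (@eq_card _ [set v | v \in I] I) => [|v]; last by rewrite inE.
by rewrite -lez_nat PoszM.
Qed.

Lemma cross_discC (t u : F) : cross_disc t u = cross_disc u t.
Proof. by rewrite /cross_disc; ring. Qed.

Lemma connect_maximal t : (4800 < p)%N -> (forall u : F, maximal u -> u != 0) ->
  maximal (3 : F) -> maximal t -> connect adjacent 3 t.
Proof.
move=> p_big neq0 m3 tm; apply/negPn/negP => nt.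
pose In := [set u | maximal u && connect adjacent 3 u].
pose Out := [set u | maximal u && ~~ connect adjacent 3 u].
pose sq u : F := u ^+ 2 - 4.
have sub_in : maximal_nbhd 3 \subset In.
  apply/subsetP => u u3; rewrite inE; apply/andP; split; last exact: connect1.
  by move: u3; rewrite inE => /andP[].
have sub_out : maximal_nbhd t \subset Out.
  apply/subsetP => u ut; have um : maximal u by move: ut; rewrite inE => /andP[].
  rewrite inE um /=; apply: contra nt => /connect_trans; apply; apply: connect1.
  by move: ut; rewrite /adjacent !inE tm um cross_discC.
have cross : (#|sq @: In| * #|sq @: Out| <= p)%N.
  apply: (leq_card_mul_nonsquare charF cardF p3mod4 (e := 16)).
  - by rewrite (natrX _ 2 4) expf_neq0.
  - move=> _ /imsetP[u + ->]; rewrite inE => /andP[um _].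
    exact: (maximal_disc charF cardF p3mod4).
  (* Any other value of [chi] would make [u] and [w] adjacent and so connect [w] to 3. *)
  move=> _ _ /imsetP[u + ->] /imsetP[w + ->]; rewrite !inE.
  move=> /andP[um u3] /andP[wm]; apply: contraNeq => ne.
  apply: (connect_trans u3); apply: connect1; rewrite /adjacent inE wm /=.
  rewrite -[cross_disc u w]/(sq u * sq w - 16); move: ne.
  by rewrite /chi; case: ifP => // _; case: ifP.
have p3 : (3 < p)%N by lia.
have d3 := card_maximal_nbhd charF cardF p3mod4 p3 m3 (neq0 _ m3).
have dt := card_maximal_nbhd charF cardF p3mod4 p3 tm (neq0 _ tm).
move: dt d3; have := subset_leq_card sub_in; have := subset_leq_card sub_out.
have := leq_card_sqr_image In 4; have := leq_card_sqr_image Out 4.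
rewrite -/(sq @: In) -/(sq @: Out); move: cross p_big.
move: #|sq @: In| #|sq @: Out| => i o; move: #|In| #|Out| => i' o'.
move: #|maximal_nbhd 3| #|maximal_nbhd t| => i2 o2.
move=> c pb h1 h2 h3 h4 h5 h6.
(* Squaring at most halves [In] and [Out], whence 64. Then [(p - 176)^2 <= 4096 p], false for
   [p > 4800]. *)
have hi : (p <= 64 * i + 176)%N by lia.
have ho : (p <= 64 * o + 176)%N by lia.
have : ((p - 176) * (p - 176) <= 4096 * (i * o))%N.
  have -> : (4096 * (i * o) = (64 * i) * (64 * o))%N by ring.
  by apply: leq_mul; lia.
nia.
Qed.

End Reachability.

(** * Integer lifts *)

Section Lifts.

Variables (p n : nat) (F : finFieldType).
Hypothesis charF : p \in [pchar F].
Hypothesis cardF : #|F| = p.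
Hypothesis p7mod8 : (p %% 8 = 7)%N.
Hypothesis p_pow2 : (2 ^ n = p.+1)%N.

Let p3mod4 : (p %% 4 = 3)%N. Proof. by lia. Qed.

(* [surface] is the Markoff equation in the coordinates [3 x_i]. *)
Definition liftable (x y z : F) : Prop :=
  exists a b c : int, markoff a b c /\
    [/\ 3 * a%:~R = x, 3 * b%:~R = y & 3 * c%:~R = z].

Lemma liftable_swap12 x y z : liftable x y z -> liftable y x z.
Proof.
case=> a [b [c [m [xa yb zc]]]]; exists b, a, c; split=> //.
transitivity (a ^+ 2 + b ^+ 2 + c ^+ 2); first by ring.
by rewrite m; ring.
Qed.

Lemma liftable_swap23 x y z : liftable x y z -> liftable x z y.
Proof.
case=> a [b [c [m [xa yb zc]]]]; exists a, c, b; split=> //.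
transitivity (a ^+ 2 + b ^+ 2 + c ^+ 2); first by ring.
by rewrite m; ring.
Qed.

Lemma surface_swap12 (x y z : F) : surface x y z = surface y x z.
Proof. by rewrite /surface (addrC (x ^+ 2)) (mulrC x). Qed.

Lemma surface_swap23 (x y z : F) : surface x y z = surface x z y.
Proof. by rewrite /surface addrAC mulrAC. Qed.

(** At [x = -2] the equation reads [(y + z)^2 = -4], but -1 is not a square. *)
Lemma surface_neqN2 (x y z : F) : surface x y z -> x != -2.
Proof.
move=> /eqP s; apply/eqP => x2; have two0 := two_neq0 charF cardF p3mod4.
have e : (y + z) ^+ 2 = - 2 ^+ 2.
  apply/eqP; rewrite -subr_eq0; move/eqP: s; rewrite -subr_eq0 x2.
  by congr (_ == 0); ring.
have := chiN charF cardF p3mod4 (2 ^+ 2); rewrite -e (chi_sqr charF cardF p3mod4 two0).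
have [yz|yz] := eqVneq (y + z) 0; first by rewrite yz expr0n chi0.
by rewrite (chi_sqr charF cardF p3mod4).
Qed.

(** The Vieta move [b -> 3 a c - b] on integer solutions reduces to [rot_step]. *)
Lemma liftable_step t v : liftable t v.1 v.2 ->
  liftable t (rot_step t v).1 (rot_step t v).2.
Proof.
case=> a [b [c [m [ta vb vc]]]]; exists a, c, (3 * a * c - b); split.
  transitivity (a ^+ 2 + b ^+ 2 + c ^+ 2 + (3 * a * c) * (3 * a * c - 2 * b)).
    by ring.
  by rewrite m; ring.
by split; rewrite // /rot_step /= -ta -vb -vc rmorphB !rmorphM /=; ring.
Qed.

Definition conic_liftable (t : F) : Prop :=
  forall v, v \in conic t -> liftable t v.1 v.2.

Lemma conic_liftable_of_point t v : maximal t -> v \in conic t ->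
  liftable t v.1 v.2 -> conic_liftable t.
Proof.
move=> tm vt lv w wt; have t0 := maximal_neq0 charF cardF p3mod4 p7mod8 tm.
have [k ->] := rot_step_transitive charF cardF p3mod4 p_pow2 tm t0 vt wt.
by elim: k => //= k; apply: liftable_step.
Qed.

(** Adjacency gives a point [(t, u, z)] lying on both conics; its lift spreads over the conic of
    [u]. *)
Lemma conic_liftable_adjacent t u : maximal t -> adjacent t u ->
  conic_liftable t -> conic_liftable u.
Proof.
move=> tm; rewrite /adjacent inE => /andP[um tu] tl.
have [z tuz] := (surface_chi charF cardF p3mod4 t u).2 tu.
apply: (@conic_liftable_of_point _ (t, z)) => //.
  by rewrite inE /= -surface_swap12.
by apply: liftable_swap12; apply: (tl (u, z)); rewrite inE.
Qed.

Lemma conic_liftable_connect t : maximal (3 : F) -> connect (@adjacent F) 3 t ->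
  conic_liftable t.
Proof.
move=> m3; have l3 : conic_liftable 3.
  apply: (@conic_liftable_of_point _ (3, 3)) => //.
    by rewrite inE /surface /=; apply/eqP; ring.
  by exists 1, 1, 1; split=> //; split; rewrite mulr1.
case/connectP=> s + ->.
elim: s (3 : F) m3 l3 => //= u s IH t' m' l' /andP[tu]; apply: IH.
  by move: tu; rewrite /adjacent inE => /andP[].
exact: conic_liftable_adjacent tu l'.
Qed.

End Lifts.

(** * Admissible exponents and conclusion *)

Lemma rotation_order_gt (F : finFieldType) (x : F) (m : nat) :
  (m <= #[markoff_rot x]%g)%N ->
  forall k, (0 < k < m)%N -> rotation (3 * x) ^+ k != 1.
Proof.
move=> mx k /andP[k0 km]; apply/eqP => h.
have /(dvdn_leq k0)/(leq_trans mx) : (#[markoff_rot x]%g %| k)%N.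
  by rewrite order_dvdn -val_eqE FinRing.val_unitX; apply/eqP.
by rewrite leqNgt km.
Qed.

(** From [n = 13] on, [2 ^ n - 1 >= 8191] exceeds the threshold 4800 of [connect_maximal]. *)
Lemma mersenne_exponent (n : nat) : prime (2 ^ n - 1) -> (5 < 2 ^ n - 1)%N ->
  ((2 ^ n - 1) %% 5 = 2)%N \/ ((2 ^ n - 1) %% 5 = 3)%N ->
  [\/ n = 3%N, n = 7%N | (13 <= n)%N].
Proof.
move=> pr gt5 m5; have [lt13|] := ltnP n 13; last by constructor 3.
have np d : (1 < d)%N -> (d < 2 ^ n - 1)%N -> (d %| 2 ^ n - 1)%N -> False.
  by move=> d1 dm dv; have /primeP[_ /(_ _ dv)] := pr; case/orP => /eqP; lia.
case: n {pr} gt5 m5 np lt13 => [|[|[|[|[|[|[|[|[|[|[|[|[|k]]]]]]]]]]]]] // gt5 m5 np lt13;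
  try (by constructor 1); try (by constructor 2); try (by case: m5).
(* The surviving exponents 6, 10 and 11 give the composites 63, 1023 and [2047 = 23 * 89]. *)
- by case: (np 3%N).
- by case: (np 3%N).
by case: (np 23%N).
Qed.

Theorem theorem1p1 (p : nat) (p_gt5 : (5 < p)%N) (p_mersenne : mersenne_prime p)
    (p_mod5 : (p%:Z = 2 %[mod 5])%Z \/ (p%:Z = -2 %[mod 5])%Z)
    (x : 'rV['F_p]_3)
    (x_markoff : markoff (x 0 0) (x 0 1) (x 0 2))
    (x_order : exists i : 'I_3, (p + 1 <= #[markoff_rot (x 0 i)%R]%g)%N) :
  exists a b c : int, markoff a b c /\
    [/\ a%:~R = x 0 0, b%:~R = x 0 1 & c%:~R = x 0 2].
Proof.
have [p_prime [n pn]] := p_mersenne.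
have charF : p \in [pchar 'F_p] := pchar_Fp p_prime.
have cardF : #|'F_p| = p := card_Fp p_prime.
have p5 : (p %% 5 = 2)%N \/ (p %% 5 = 3)%N.
  by move: p_mod5; rewrite !modz_nat; case => h; [left|right]; lia.
have n_cases : [\/ n = 3%N, n = 7%N | (13 <= n)%N].
  by apply: mersenne_exponent; rewrite -pn.
have n_ge3 : (3 <= n)%N by case: n_cases => [->|->|/ltnW/(leq_trans _)->].
have p_pow2 : (2 ^ n = p.+1)%N by rewrite pn subn1 prednK ?expn_gt0.
have p7mod8 : (p %% 8 = 7)%N.
  by move: p_pow2; rewrite -(subnKC n_ge3) expnD (_ : 2 ^ 3 = 8)%N //; lia.
have p3mod4 : (p %% 4 = 3)%N by lia.
have three0 : 3 != 0 :> 'F_p by apply: (natr_neq0 charF cardF p3mod4); lia.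
have m3 : maximal (3 : 'F_p).
  have e1 : 3 - 2 = 1 :> 'F_p by ring.
  have e5 : 3 + 2 = 5 :> 'F_p by ring.
  rewrite /maximal e1 e5 chi1.
  by rewrite (chi5 charF cardF p3mod4 p_gt5 p5).
have reach (t : 'F_p) : maximal t -> connect (@adjacent 'F_p) 3 t.
  move=> tm; case: n_cases => [n3|n7|n13].
  - have p7 : p = 7%N by rewrite pn n3.
    by apply: (connect_of_hubs charF cardF p3mod4 (hubs := [:: 1%N])) tm;
      rewrite p7 hubs_mod7.
  - have p127 : p = 127%N by rewrite pn n7.
    by apply: (connect_of_hubs charF cardF p3mod4 (hubs := [:: 1; 16; 49]%N)) tm;
      rewrite p127 hubs_mod127.
  apply: (connect_maximal charF cardF p3mod4) => //.
    have : (2 ^ 13 <= 2 ^ n)%N by rewrite leq_exp2l.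
    by rewrite p_pow2; lia.
  by move=> u; apply: (maximal_neq0 charF cardF p3mod4 p7mod8).
have lift (y z w : 'F_p) : surface (3 * y) (3 * z) (3 * w) ->
    (p + 1 <= #[markoff_rot y]%g)%N -> liftable (3 * y) (3 * z) (3 * w).
  move=> s; rewrite addn1 => /rotation_order_gt ord.
  have ym : maximal (3 * y).
    apply: (maximal_of_order charF cardF p3mod4); last exact: ord.
    exact: (surface_neqN2 charF cardF p7mod8 p_pow2 s).
  have := conic_liftable_connect charF cardF p7mod8 p_pow2 m3 (reach _ ym).
  by move/(_ (3 * z, 3 * w)); apply; rewrite inE.
have s : surface (3 * x 0 0) (3 * x 0 1) (3 * x 0 2).
  rewrite /surface; apply/eqP.
  transitivity (9 * (x 0 0 ^+ 2 + x 0 1 ^+ 2 + x 0 2 ^+ 2)); first by ring.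
  by rewrite x_markoff; ring.
suff [a [b [c [m [ha hb hc]]]]] : liftable (3 * x 0 0) (3 * x 0 1) (3 * x 0 2).
  by exists a, b, c; split=> //; split; apply: (mulfI three0).
(* By symmetry the coordinate of large order is moved to the front. *)
case: x_order => -[[|[|[|//]]] i3] ord.
- apply: lift s _.
  by move: ord; congr (_ <= #[markoff_rot (x 0 _)%R]%g)%N; apply: val_inj.
- apply: liftable_swap12; apply: lift; first by rewrite surface_swap12.
  by move: ord; congr (_ <= #[markoff_rot (x 0 _)%R]%g)%N; apply: val_inj.
apply: liftable_swap23; apply: liftable_swap12; apply: lift.
  by rewrite surface_swap12 surface_swap23.
by move: ord; congr (_ <= #[markoff_rot (x 0 _)%R]%g)%N; apply: val_inj.
Qed.
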